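(* Let $J\in\mathbb{R}^{3\times 3}$ be symmetric positive definite, let $d_{\max}\ge 0$, $\beta_1>0$ and $0<\beta_2<1$ be constants, and let $\boldsymbol{d}:[0,\infty)\to\mathbb{R}^3$ be a disturbance torque with $\lVert \boldsymbol{d}(t)\rVert\le d_{\max}$ for all $t\geq 0$. Let $\boldsymbol{\omega}_{\mathcal B},\boldsymbol{\omega}_{\mathcal D},\boldsymbol{\omega}_R:[0,\infty)\to\mathbb{R}^3$ be, respectively, the body angular velocity, the angular velocity of the desired frame, and the regulating rate, all expressed in the body frame $\mathcal B$ and all locally absolutely continuous, and define $$\boldsymbol{s}=\boldsymbol{\omega}_{\mathcal D}+\boldsymbol{\omega}_R-\boldsymbol{\omega}_{\mathcal B},\qquad s=\lVert\boldsymbol{s}\rVert,\qquad \hat{\boldsymbol{s}}=\begin{cases}\boldsymbol{s}/s & \text{if } s>0,\\ 0 & \text{if } s=0.\end{cases}$$ Suppose that the attitude dynamics $$J\dot{\boldsymbol{\omega}}_{\mathcal B}=\boldsymbol{u}+\boldsymbol{d}-\boldsymbol{\omega}_{\mathcal B}\times J\boldsymbol{\omega}_{\mathcal B}$$ hold under the control law $$\boldsymbol{u}=J\left(\dot{\boldsymbol{\omega}}_{\mathcal D}+\dot{\boldsymbol{\omega}}_R+\beta_1 s^{\beta_2}\hat{\boldsymbol{s}}\right)+d_{\max}\hat{\boldsymbol{s}}+\boldsymbol{\omega}_{\mathcal B}\times J\boldsymbol{\omega}_{\mathcal B}$$ at almost every time $t\ge 0$ at which $\boldsymbol{s}(t)\neq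 0$. Then the control law drives the state to the sliding manifold $\boldsymbol{s}=0$ within finite time: there exists $T<\infty$ such that $\boldsymbol{s}(T)=0$.
   Context: The setting is rigid spacecraft attitude tracking: the body frame $\mathcal B$ is to track a desired frame $\mathcal D$. $J$ is the inertia matrix of the spacecraft in the body frame, $\boldsymbol{u}$ is the control torque, and $\boldsymbol{d}$ is an external disturbance torque whose norm is bounded by the known constant $d_{\max}$. All vectors are written as coordinate vectors in $\mathcal B$, and a dot denotes the time derivative taken in $\mathcal B$, i.e. the componentwise derivative of the $\mathcal B$-coordinates. $\lVert\cdot\rVert$ is the Euclidean norm and $\times$ is the cross product in $\mathbb{R}^3$. The regulating rate $\boldsymbol{\omega}_R$ is an arbitrary angular velocity signal (a design choice). The control law is applied without any saturation of $\boldsymbol{u}$. *)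

(* Defs.v *)
From HB Require Import structures.
From mathcomp Require Import all_boot all_order all_algebra.
From mathcomp Require Import all_classical all_reals all_analysis.

Set Implicit Arguments.
Unset Strict Implicit.
Unset Printing Implicit Defensive.

Import Order.TTheory GRing.Theory Num.Theory.
Import numFieldNormedType.Exports.

Local Open Scope classical_set_scope.
Local Open Scope ring_scope.

Section vectors.
Context {R : realType}.
Implicit Types (u v : 'cV[R]_3) (w : R -> 'cV[R]_3).

(* The library norm `|v| on matrices is the sup norm, hence this one. *)
Definition enorm v : R := Num.sqrt (\sum_i v i 0 ^+ 2).

(* Index arithmetic in 'I_3 is modulo 3. *)
Definition cross u v : 'cV[R]_3 :=
  \col_(i < 3) (u (i + 1) 0 * v (i + 2) 0 - u (i + 2) 0 * v (i + 1) 0).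

Definition direction v : 'cV[R]_3 :=
  if 0 < enorm v then (enorm v)^-1 *: v else 0.

(* derive1 is total: its value is unspecified where a coordinate is not
   differentiable, a null set of times when w is locally absolutely
   continuous. *)
Definition dot w (t : R) : 'cV[R]_3 := \col_i derive1 (fun x => w x i 0) t.

Definition posdefmx n (A : 'M[R]_n) :=
  forall x : 'cV[R]_n, x != 0 -> 0 < (x^T *m A *m x) 0 0.

Definition abs_cont (a b : R) w :=
  forall e : R, 0 < e -> exists2 d : R, 0 < d &
    forall (n : nat) (l r : 'I_n -> R),
      (forall i, a <= l i /\ l i <= r i /\ r i <= b) ->
      trivIset setT (fun i => `]l i, r i[%classic) ->
      \sum_(i < n) (r i - l i) < d ->
      \sum_(i < n) enorm (w (r i) - w (l i)) < e.

(* Signals on [0, +oo[ are total functions on R; values at negative times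
   are irrelevant. *)
Definition loc_abs_cont w :=
  forall a b : R, 0 <= a -> a <= b -> abs_cont a b w.

End vectors.

(* Main.v *)
(* Put V = s^T J s and p = (1 - beta2) / 2.  Wherever the three signals are
   differentiable and the closed loop holds, substituting the control law gives
   V' <= - 2 beta1 |s|^(beta2 - 1) V: the disturbance is absorbed by the dmax
   term, by Cauchy-Schwarz.  Since |s|^2 <= K V, the derivative of V^p is at
   most a negative constant.  If s never vanished, V^p would be absolutely
   continuous on every [0, T], hence below its initial value minus a multiple
   of T, and negative for large T.

   This needs that an absolutely continuous function is differentiable almost
   everywhere and is the integral of its derivative.  Subtracting it from its
   total variation function reduces this to nondecreasing functions; their
   Lebesgue-Stieltjes measure is dominated by Lebesgue measure, so it has a
   Radon-Nikodym density, to which Lebesgue differentiation applies. *)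

Require Import Defs.
From HB Require Import structures.
From mathcomp Require Import all_boot all_order all_algebra ring lra.
From mathcomp Require Import all_classical all_reals all_analysis.

Import Order.TTheory GRing.Theory Num.Theory.
Import numFieldNormedType.Exports.

Local Open Scope classical_set_scope.
Local Open Scope ring_scope.

(* A scalar version of [abs_cont], indexed by arbitrary finite types so that
   families of intervals can be refined without reindexing. *)
Definition abs_cont_on {R : realType} (a b : R) (f : R -> R) :=
  forall e : R, 0 < e -> exists2 d : R, 0 < d &
    forall (I : finType) (l r : I -> R),
      (forall i, a <= l i /\ l i <= r i /\ r i <= b) ->
      trivIset setT (fun i => `]l i, r i[%classic) ->
      \sum_i (r i - l i) < d ->
      \sum_i `|f (r i) - f (l i)| < e.

(** * Euclidean norm and reduction of vector signals to coordinates *)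

Section vectors.
Set Implicit Arguments.
Unset Strict Implicit.
Context {R : realType}.

Lemma enorm_ge0 (v : 'cV[R]_3) : 0 <= enorm v.
Proof. exact: sqrtr_ge0. Qed.

Lemma sqr_enorm (v : 'cV[R]_3) : enorm v ^+ 2 = \sum_i v i 0 ^+ 2.
Proof. by rewrite sqr_sqrtr// sumr_ge0// => i _; exact: sqr_ge0. Qed.

Lemma le_enorm (v : 'cV[R]_3) i : `|v i 0| <= enorm v.
Proof.
rewrite -(@ler_pXn2r _ 2) ?nnegrE ?enorm_ge0// sqr_enorm real_normK ?num_real//.
by rewrite (bigD1 i)//= lerDl sumr_ge0// => j _; exact: sqr_ge0.
Qed.

(** A coordinate increment is at most the norm of the vector increment; [enum_val] turns a family
    over any finite type into one over an ordinal. *)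
Lemma abs_cont_coord (a b : R) (w : R -> 'cV[R]_3) i :
  abs_cont a b w -> abs_cont_on a b (fun t => w t i 0).
Proof.
move=> acw e /acw[d d0 H]; exists d => // I l r lr tI sd.
pose l' (j : 'I_#|I|) := l (enum_val j).
pose r' (j : 'I_#|I|) := r (enum_val j).
have lr' j : a <= l' j /\ l' j <= r' j /\ r' j <= b by exact: lr.
have bij : {on predT, bijective (@enum_val I predT)}.
  by apply/onW_bij; exact: enum_val_bij.
apply: le_lt_trans (H _ l' r' lr' _ _).
- rewrite (reindex (@enum_val I predT))//=; apply: ler_sum => j _.
  by apply: le_trans (le_enorm _ i); rewrite !mxE.
- apply/trivIsetP => j k _ _ jk; move/trivIsetP : tI; apply => //.
  by apply: contra jk => /eqP/enum_val_inj ->.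
- by move: sd; rewrite (reindex (@enum_val I predT)).
Qed.

End vectors.

(** * Closure properties and continuity of absolutely continuous functions *)

Section abs_cont_on.
Set Implicit Arguments.
Unset Strict Implicit.
Context {R : realType}.
Implicit Types (a b : R) (f g h : R -> R).

(** Common source of closure properties: it suffices to bound increments linearly by those of two
    known functions. *)
Lemma abs_cont_on_dom a b (A B : R) f g h :
  abs_cont_on a b f -> abs_cont_on a b g ->
  (forall x y, a <= x -> x <= y -> y <= b ->
    `|h y - h x| <= A * `|f y - f x| + B * `|g y - g x|) ->
  abs_cont_on a b h.
Proof.
move=> acf acg hfg e e0.
(* One positive constant above both [A] and [B], whatever their signs; each of the two sums gets the
   budget [e / 2 / M]. *)
pose M := 1 + `|A| + `|B|.
have M0 : 0 < M by rewrite /M -addrA ltr_pwDl// addr_ge0.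
have AM : A <= M by rewrite (le_trans (ler_norm A))// /M addrAC lerDr addr_ge0.
have BM : B <= M by rewrite (le_trans (ler_norm B))// lerDr addr_ge0.
have e'0 : 0 < e / 2 / M by rewrite !divr_gt0.
have [d1 d10 H1] := acf _ e'0; have [d2 d20 H2] := acg _ e'0.
exists (Num.min d1 d2); first by rewrite lt_min d10.
move=> I l r lr tI; rewrite lt_min => /andP[s1 s2].
have {s1}F1 := H1 _ _ _ lr tI s1; have {s2}F2 := H2 _ _ _ lr tI s2.
apply: (@le_lt_trans _ _ (\sum_i (M * `|f (r i) - f (l i)| +
                                  M * `|g (r i) - g (l i)|))).
  apply: ler_sum => i _; have [al [lri rb]] := lr i.
  by rewrite (le_trans (hfg _ _ al lri rb))// lerD// ler_wpM2r.
rewrite big_split/= -!mulr_sumr -mulrDr mulrC -ltr_pdivlMr//.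
by rewrite [in ltRHS](splitr e) mulrDl ltrD.
Qed.

Lemma abs_cont_on_cst a b c : abs_cont_on a b (fun=> c).
Proof.
move=> e e0; exists 1 => // I l r _ _ _.
by under eq_bigr do rewrite subrr normr0; rewrite big1.
Qed.

Lemma abs_cont_onB a b f g :
  abs_cont_on a b f -> abs_cont_on a b g -> abs_cont_on a b (fun x => f x - g x).
Proof.
move=> acf acg; apply: (@abs_cont_on_dom _ _ 1 1 f g) => // x y _ _ _.
by rewrite !mul1r (_ : _ - _ = (f y - f x) - (g y - g x)) ?ler_normB//; ring.
Qed.

Lemma abs_cont_onD a b f g :
  abs_cont_on a b f -> abs_cont_on a b g -> abs_cont_on a b (fun x => f x + g x).
Proof.
move=> acf acg; apply: (@abs_cont_on_dom _ _ 1 1 f g) => // x y _ _ _.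
by rewrite !mul1r (_ : _ - _ = (f y - f x) + (g y - g x)) ?ler_normD//; ring.
Qed.

Lemma abs_cont_on_sum a b n (F : 'I_n -> R -> R) :
  (forall i, abs_cont_on a b (F i)) -> abs_cont_on a b (fun x => \sum_i F i x).
Proof.
elim: n F => [|n IH] F acF.
  by under eq_fun do rewrite big_ord0; exact: abs_cont_on_cst.
under eq_fun do rewrite big_ord_recr/=.
apply: (@abs_cont_onD _ _ (fun x => \sum_(i < n) F (widen_ord (leqnSn n) i) x)
  (F ord_max)) => //.
by apply: (IH (fun i => F (widen_ord (leqnSn n) i))) => i; exact: acF.
Qed.

(** A family consisting of one interval, indexed by [unit], already gives uniform continuity. *)
Lemma abs_cont_on_near a b f e : abs_cont_on a b f -> 0 < e ->
  exists2 d, 0 < d & forall x y, a <= x -> x <= y -> y <= b -> y - x < d ->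
    `|f y - f x| < e.
Proof.
move=> acf /acf[d d0 H]; exists d => // x y ax xy yb xyd.
have := H unit (fun=> x) (fun=> y); rewrite !big_const card_unit/= !addr0; apply=> //.
by apply/trivIsetP => -[] [].
Qed.

(** For [a <= b], the retraction of the line onto [[a, b]]: [f \o clamp a b] extends [f] by its end
    values, so that results about functions on all of [R] apply. *)
Definition clamp a b (x : R) := Num.max a (Num.min b x).

Lemma clamp_ge a b x : a <= clamp a b x.
Proof. by rewrite le_max lexx. Qed.

Lemma clamp_le a b x : a <= b -> clamp a b x <= b.
Proof. by move=> ab; rewrite ge_max ab ge_min lexx. Qed.

Lemma clamp_id a b x : a <= x -> x <= b -> clamp a b x = x.
Proof. by move=> ax xb; rewrite /clamp min_r// max_r. Qed.

Lemma clamp_homo a b x y : x <= y -> clamp a b x <= clamp a b y.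
Proof.
move=> xy; rewrite /clamp ge_max !le_max lexx/=.
by rewrite le_min !ge_min lexx xy/= orbT orbT.
Qed.

Lemma clamp_lip a b x y : a <= b -> x <= y -> clamp a b y - clamp a b x <= y - x.
Proof.
move=> ab xy; rewrite /clamp /Num.max /Num.min.
by repeat case: ifP => /=; move=> *; lra.
Qed.

Lemma clamp_continuous a b f : a <= b -> abs_cont_on a b f ->
  continuous (f \o clamp a b).
Proof.
move=> ab acf x; apply/cvgrPdist_lt => e e0.
have [d d0 H] := abs_cont_on_near acf e0.
have K y z : y <= z -> z - y < d -> `|f (clamp a b z) - f (clamp a b y)| < e.
  move=> yz yzd; apply: H; rewrite ?clamp_ge ?clamp_le ?clamp_homo//.
  exact: le_lt_trans (clamp_lip ab yz) yzd.
near=> y => /=.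
have : `|x - y| < d by near: y; exact: cvgr_dist_lt.
have [xy|yx] := leP x y.
  by rewrite distrC [in X in _ -> X]distrC ger0_norm ?subr_ge0//; exact: K.
by rewrite gtr0_norm ?subr_gt0//; apply: K; exact: ltW.
Unshelve. all: by end_near. Qed.

Lemma abs_cont_on_within_continuous a b f : a <= b -> abs_cont_on a b f ->
  {within `[a, b], continuous f}.
Proof.
move=> ab acf.
apply: (@subspace_eq_continuous _ _ _ (f \o clamp a b)).
  by move=> x; rewrite inE/= in_itv/= => /andP[ax xb]; rewrite /= clamp_id.
by apply: continuous_subspaceT => x; exact: clamp_continuous.
Qed.

End abs_cont_on.

(** * Total variation of absolutely continuous functions *)

Section total_variation.
Context {R : realType}.
Set Implicit Arguments.
Unset Strict Implicit.
Implicit Types (a b : R) (f : R -> R).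

Lemma variation_ord a b f s : variation a b f s =
  \sum_(i < size s) `|f (nth b (a :: s) i.+1) - f (nth b (a :: s) i)|.
Proof. by rewrite /variation big_mkord. Qed.

Lemma itv_partition_nth_homo a b s : itv_partition a b s ->
  {in gtn (size s).+1 &, {homo nth b (a :: s) : i j / (i <= j)%N >-> i <= j}}.
Proof.
move=> [ps _]; have : sorted <=%R (a :: s) by exact: (sub_path ltW).
by move/(sorted_leq_nth le_trans le_refl) => H i j iS jS; exact: (H b).
Qed.

Lemma itv_partition_trivIset a b s : itv_partition a b s ->
  trivIset setT (fun i : 'I_(size s) =>
    `]nth b (a :: s) i, nth b (a :: s) i.+1[%classic).
Proof.
move=> abs; apply/trivIsetP.
have H (i j : 'I_(size s)) : (i < j)%N ->
    `]nth b (a :: s) i, nth b (a :: s) i.+1[%classic `&`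
    `]nth b (a :: s) j, nth b (a :: s) j.+1[%classic = set0.
  move=> ij; apply/seteqP; split=> // x [] /=.
  rewrite !in_itv/= => /andP[_ xi] /andP[jx _].
  have : nth b (a :: s) i.+1 <= nth b (a :: s) j.
    apply: itv_partition_nth_homo => //; rewrite inE ltnS ?ltn_ord//.
    by rewrite ltnW.
  by move=> /(lt_le_trans xi)/lt_trans/(_ jx); rewrite ltxx.
move=> i j _ _; rewrite neq_ltn => /orP[|] ij; first exact: H.
by rewrite setIC; exact: H.
Qed.

(** Partitioning each interval of a disjoint family gives a disjoint family of the same total
    length, indexed by a sigma type; so the [d] of absolute continuity serves unchanged. *)
Lemma abs_cont_on_variation a b f e : abs_cont_on a b f -> 0 < e ->
  exists2 d, 0 < d & forall (I : finType) (l r : I -> R) (s : I -> seq R),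
    (forall i, a <= l i /\ l i <= r i /\ r i <= b) ->
    trivIset setT (fun i => `]l i, r i[%classic) ->
    \sum_i (r i - l i) < d ->
    (forall i, itv_partition (l i) (r i) (s i)) ->
    \sum_i variation (l i) (r i) f (s i) < e.
Proof.
move=> acf /acf[d d0 H]; exists d => // I l r s lr tI sd ps.
pose J := {i : I & 'I_(size (s i))}.
pose x (p : J) k := nth (r (tag p)) (l (tag p) :: s (tag p)) k.
have xl p k : (k < (size (s (tag p))).+1)%N -> l (tag p) <= x p k.
  by move=> kp; exact: itv_partition_nth_ge.
have xr p k : (k < (size (s (tag p))).+1)%N -> x p k <= r (tag p).
  by move=> kp; exact: itv_partition_nth_le.
rewrite (eq_bigr _ (fun i _ => variation_ord _ _ _ _)) sig_big_dep /=.
apply: (H J (fun p => x p (tagged p)) (fun p => x p (tagged p).+1)).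
- move=> p; have [al [_ rb]] := lr (tag p); split; last split.
  + by apply: le_trans al _; apply: xl; rewrite ltnS ltnW.
  + by apply: itv_partition_nth_homo => //; rewrite inE ltnS// ltnW.
  + by apply: le_trans _ rb; apply: xr; rewrite ltnS.
(* Pieces of one interval are disjoint by its partition; pieces of different intervals inherit
   disjointness from those intervals. *)
- apply/trivIsetP => -[i k] [j m] _ _ /= ij.
  have [eqij|neij] := eqVneq i j.
    subst j; move/trivIsetP : (itv_partition_trivIset (ps i)); apply => //.
    by apply: contra ij => /eqP ->.
  apply/seteqP; split=> // z [] /=; rewrite !in_itv/= => /andP[z1 z2] /andP[z3 z4].
  suff : (`]l i, r i[%classic `&` `]l j, r j[%classic) z.
    by move/trivIsetP : tI => /(_ i j Logic.I Logic.I neij) ->.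
  rewrite /= !in_itv/=; split; apply/andP; split.
  + by apply: le_lt_trans z1; apply: (xl (existT _ i k : J) k); rewrite ltnS ltnW/=.
  + by apply: lt_le_trans z2 _; apply: (xr (existT _ i k : J) k.+1); rewrite ltnS/=.
  + by apply: le_lt_trans z3; apply: (xl (existT _ j m : J) m); rewrite ltnS ltnW/=.
  + by apply: lt_le_trans z4 _; apply: (xr (existT _ j m : J) m.+1); rewrite ltnS/=.
- rewrite -(sig_big_dep xpredT (fun i _ => true)
    (fun i (k : 'I_(size (s i))) =>
      nth (r i) (l i :: s i) k.+1 - nth (r i) (l i :: s i) k))/=.
  rewrite (le_lt_trans _ sd)//; apply: ler_sum => i _.
  rewrite -(big_mkord xpredT (fun k =>
      nth (r i) (l i :: s i) k.+1 - nth (r i) (l i :: s i) k)).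
  rewrite telescope_sumr//= -last_nth.
  by have [_ /eqP ->] := ps i.
Qed.

(** An interval shorter than the [d] belonging to [e = 1] has variation at most [1], and finitely
    many steps of length [d / 2] cover [[x, y]]. *)
Lemma abs_cont_on_bounded_variation a b f x y : abs_cont_on a b f ->
  a <= x -> x <= y -> y <= b -> bounded_variation x y f.
Proof.
move=> acf ax xy yb; have ab : a <= b by rewrite (le_trans ax)// (le_trans xy).
have [d d0 H] := abs_cont_on_variation acf ltr01.
have small u v : a <= u -> u <= v -> v <= b -> v - u < d ->
    bounded_variation u v f.
  move=> au uv vb uvd; exists 1 => _ [s uvs <-]; apply/ltW.
  have := H unit (fun=> u) (fun=> v) (fun=> s).
  rewrite !big_const card_unit/= !addr0; apply=> //.
  by apply/trivIsetP => -[] [].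
suff K n : forall z, x <= z -> z <= y -> z <= x + (d / 2) * n%:R ->
    bounded_variation x z f.
  apply: (K (Num.bound ((y - x) / (d / 2)))) => //.
  rewrite -lerBlDl mulrC -ler_pdivrMr ?divr_gt0// ltW// archi_boundP//.
  by rewrite !divr_ge0 ?subr_ge0// ltW.
elim: n => [|n IH] z xz zy zn.
  rewrite (_ : z = x); first exact: bounded_variationxx.
  by apply/eqP; rewrite eq_le xz andbT; rewrite mulr0 addr0 in zn.
(* The last step [[w, z]] is shorter than [d], and [w] is within [n] steps of [x]; the maximum keeps
   [w] from passing below [x]. *)
pose w := Num.max x (z - d / 2).
have xw : x <= w by rewrite le_max lexx.
have wz : w <= z by rewrite ge_max xz/= gerBl divr_ge0// ltW.
apply/bounded_variationP => //; rewrite (total_variationD _ xw wz) fin_numD.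
apply/andP; split; apply/bounded_variationP => //.
- apply: IH => //; first exact: le_trans zy.
  rewrite ge_max lerDl mulr_ge0 ?divr_ge0 ?(ltW d0)//=.
  by move: zn; rewrite -[n.+1%:R]natr1 mulrDr mulr1 addrA -lerBlDr.
- apply: small => //; first exact: le_trans xw.
    exact: le_trans zy yb.
  rewrite ltrBlDr -ltrBlDl lt_max; apply/orP; right.
  by rewrite ltrD2l ltrN2 ltr_pdivrMr// ltr_pMr// ltr1n.
Qed.

Lemma abs_cont_on_fin_tv a b f x y : abs_cont_on a b f ->
  a <= x -> x <= y -> y <= b -> total_variation x y f \is a fin_num.
Proof.
move=> *; apply/bounded_variationP => //.
exact: (@abs_cont_on_bounded_variation a b).
Qed.

Lemma fine_total_variationB a b f x y : abs_cont_on a b f ->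
  a <= x -> x <= y -> y <= b ->
  fine (total_variation a y f) - fine (total_variation a x f) =
  fine (total_variation x y f).
Proof.
move=> acf ax xy yb.
have fx : total_variation a x f \is a fin_num.
  by apply: (abs_cont_on_fin_tv acf) => //; exact: le_trans yb.
have fy : total_variation x y f \is a fin_num by exact: (abs_cont_on_fin_tv acf).
by rewrite (total_variationD f ax xy) (fineD fx fy) addrC addKr.
Qed.

Lemma fine_total_variation_ge a b f x y : abs_cont_on a b f ->
  a <= x -> x <= y -> y <= b ->
  `|f y - f x| <= fine (total_variation a y f) - fine (total_variation a x f).
Proof.
move=> acf ax xy yb; rewrite (fine_total_variationB acf)//.
by rewrite -lee_fin fineK ?(abs_cont_on_fin_tv acf)// total_variation_ge.
Qed.

(** Nearly optimal partitions replace the total variations by finite sums, which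
    [abs_cont_on_variation] controls. *)
Lemma abs_cont_on_total_variation a b f : abs_cont_on a b f ->
  abs_cont_on a b (fun x => fine (total_variation a x f)).
Proof.
move=> acf e e0; have e20 : 0 < e / 2 by rewrite divr_gt0.
have [d d0 H] := abs_cont_on_variation acf e20.
exists d => // I l r lr tI sd.
(* Slack per interval: the [#|I|] slacks add up to less than [e / 2], also when [I] is empty. *)
pose c := e / 2 / #|I|.+1%:R.
have c0 : 0 < c by rewrite divr_gt0.
have /choice[s ps] : forall i, exists s, itv_partition (l i) (r i) s /\
    fine (total_variation (l i) (r i) f) < variation (l i) (r i) f s + c.
  move=> i; have [al [lri rb]] := lr i.
  have fin := abs_cont_on_fin_tv acf al lri rb.
  have [_ [_ [s ps <-] <-] sv] := ub_ereal_sup_adherent c0 fin.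
  exists s; split=> //; rewrite -ltrBlDr -lte_fin EFinB fineK//.
have Hv := H I l r s lr tI sd (fun i => proj1 (ps i)).
apply: (@le_lt_trans _ _ (\sum_i (variation (l i) (r i) f (s i) + c))).
  apply: ler_sum => i _; have [al [lri rb]] := lr i.
  rewrite ger0_norm ?(fine_total_variationB acf)//; first exact/ltW/(proj2 (ps i)).
  exact/fine_ge0/total_variation_ge0.
rewrite big_split/= sumr_const (splitr e) ltrD// -[ltLHS]mulr_natr /c.
by rewrite mulrAC ltr_pdivrMr// ltr_pM2l// ltr_nat.
Qed.

End total_variation.

(** * Lebesgue's fundamental theorem of calculus *)

Section lebesgue_stieltjes.
Context {R : realType}.
Set Implicit Arguments.
Unset Strict Implicit.
Implicit Types (a b : R) (f g : R -> R).
Notation leb := (@lebesgue_measure R).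

Lemma lebesgue_stieltjes_measure_itvoc (F : cumulative R R) x y : x <= y ->
  lebesgue_stieltjes_measure F (`]x, y]%classic : set R) = (F y - F x)%:E.
Proof.
move=> xy; rewrite /lebesgue_stieltjes_measure/= /measure_extension/=.
rewrite measurable_mu_extE//; last exact: is_ocitv.
exact: wlength_itv_bnd.
Qed.

(** [Rhull] supplies the endpoints: finite measure excludes infinite ones, openness excludes
    attained ones. *)
Lemma open_itv_finiteP (U : set R) : open U -> is_interval U ->
  (leb U < +oo)%E -> exists x y, x <= y /\ U = `]x, y[%classic.
Proof.
move=> oU /is_intervalP UE Uoo; have [U0|/set0P[z Uz]] := eqVneq U set0.
  by exists 0, 0; rewrite lexx U0 set_itvoo0.
have ball_sub w : U w -> exists2 e, 0 < e & U (w - e) /\ U (w + e).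
  move=> /oU /nbhs_ballP[e /= e0 eU]; have e20 : 0 < e / 2 by rewrite divr_gt0.
  have e2e : e / 2 < e by rewrite ltr_pdivrMr// ltr_pMr// ltr1n.
  exists (e / 2) => //; split; apply: eU; rewrite /ball/=.
    by rewrite opprB addrCA subrr addr0 gtr0_norm.
  by rewrite opprD addrA subrr sub0r normrN gtr0_norm.
move: Uoo UE; case: (Rhull U) => [[bl l|[]] [br r|[]]] Uoo UE;
  move: (Uz) Uoo; rewrite {1 2}UE lebesgue_measure_itv/= in_itv/=;
  rewrite ?ltry ?ltNyr ?andbF//= => zlr _.
have lr : l <= r by move: zlr => /andP[/lteifW + /lteifW]; exact: le_trans.
exists l, r; split => //; rewrite UE.
case: bl br zlr UE => -[] /= /andP[lz zr] UE //.
- have /ball_sub[e e0 []] : U l by rewrite UE/= in_itv/= lexx (le_lt_trans lz).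
  by rewrite UE/= in_itv/= => /andP[+ _]; rewrite lerBrDl gerDr leNgt e0.
- have /ball_sub[e e0 []] : U l by rewrite UE/= in_itv/= lexx (le_trans lz).
  by rewrite UE/= in_itv/= => /andP[+ _]; rewrite lerBrDl gerDr leNgt e0.
- have /ball_sub[e e0 []] : U r by rewrite UE/= in_itv/= lexx (lt_le_trans lz).
  by rewrite UE/= !in_itv/= => _ /andP[_]; rewrite gerDl leNgt e0.
Qed.

Lemma subset_clamp a b x y :
  `]clamp a b x, clamp a b y[%classic `<=` `]x, y[%classic.
Proof.
move=> z; rewrite /= !in_itv/= /clamp /Num.max /Num.min.
by repeat case: ifP => /=; move=> *; apply/andP; split; lra.
Qed.

(** A null set lies in an open set of measure below [d]. Its components are disjoint intervals, and
    absolute continuity bounds the increments of [F] over any finitely many of them by [e] in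
    total. *)
Lemma lebesgue_stieltjes_dominates a b f (F : cumulative R R) :
  a <= b -> {in `[a, b] &, {homo f : x y / x <= y}} -> abs_cont_on a b f ->
  F =1 f \o clamp a b -> lebesgue_stieltjes_measure F `<< leb.
Proof.
move=> ab ndf acf Ff; apply/null_content_dominatesP => E mE E0.
apply/eqP; rewrite -measure_le0; apply/lee_addgt0Pr => e e0; rewrite add0e.
have [d d0 H] := acf _ e0.
have [U [oU EU]] : exists U : set R, [/\ open U, E `<=` U & (leb U < d%:E)%E].
  (* Outer regularity controls [U] minus [E]; as [E] is null, this bounds [U] itself. *)
  have := @lebesgue_regularity_outer R E d mE; rewrite E0 ltry => /(_ isT d0).
  move=> [U [oU EU UE]]; exists U; split => //.
  rewrite -(setDUK EU) measureU//.
    by rewrite E0 add0e.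
    by apply: measurableD => //; exact: measurable_realfun.open_measurable.
  by rewrite setDIK.
move=> Ud.
pose O := open_disjoint_itv oU.
have mO i : measurable (O i).
  by apply: measurable_realfun.open_measurable; exact: open_disjoint_itv_open.
have tO : trivIset setT O by exact: open_disjoint_itv_trivIset.
have UO : U = \bigcup_i O i by exact: open_disjoint_itv_bigcup.
have mU : measurable U by exact: measurable_realfun.open_measurable.
have /choice[x /choice[y xy]] : forall i, exists x y, x <= y /\ O i = `]x, y[%classic.
  move=> i; apply: open_itv_finiteP.
  - exact: open_disjoint_itv_open.
  - exact: open_disjoint_itv_is_interval.
  - apply: le_lt_trans (lt_trans Ud (ltry d)).
    apply: le_measure; rewrite ?inE; [exact: mO|exact: mU|].
    by move=> z Oz; rewrite UO; exists i.
have ndF : {homo F : u v / u <= v}.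
  exact: cumulative_is_nondecreasing.
apply: (@le_trans _ _ (lebesgue_stieltjes_measure F U)).
  by apply: le_measure; rewrite ?inE; [exact: mE|exact: mU|].
rewrite UO measure_bigcup; [|by move=> i _; exact: mO|exact: tO].
apply: lime_le.
  by apply: is_cvg_nneseries => *; exact: measure_ge0.
apply: nearW => n; apply: (@le_trans _ _ (\sum_(i < n) (F (y i) - F (x i))%:E)%E).
  rewrite big_mkcond big_mkord; apply: lee_sum => i _.
  case: ifPn => [_|]; last by rewrite lee_fin subr_ge0 ndF//; exact: (proj1 (xy i)).
  rewrite -lebesgue_stieltjes_measure_itvoc; last exact: (proj1 (xy i)).
  apply: le_measure; rewrite ?inE; [exact: mO|exact: measurable_itv|].
  by rewrite (proj2 (xy i)); exact: subset_itv_oo_oc.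
rewrite sumEFin lee_fin ltW//.
have clF i : F (y i) - F (x i) = `|f (clamp a b (y i)) - f (clamp a b (x i))|.
  have Fe z : f (clamp a b z) = F z by rewrite Ff.
  by rewrite !Fe ger0_norm// subr_ge0 ndF//; exact: (proj1 (xy i)).
rewrite (eq_bigr _ (fun (i : 'I_n) _ => clF i)).
(* Clamping moves the intervals into [[a, b]], where [H] applies, without lengthening them or making
   them overlap. *)
apply: (H _ (fun i : 'I_n => clamp a b (x i)) (fun i => clamp a b (y i))).
- by move=> i; rewrite clamp_ge clamp_le// clamp_homo//; exact: (proj1 (xy i)).
- apply/trivIsetP => i j _ _ ij; apply/seteqP; split => // z [].
  move/subset_clamp => zi /subset_clamp zj.
  move/trivIsetP : tO => /(_ i j Logic.I Logic.I ij) <-.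
  by rewrite (proj2 (xy i)) (proj2 (xy j)); split.
- rewrite -lte_fin (le_lt_trans _ Ud)// UO.
  rewrite measure_bigcup; [|by move=> i _; exact: mO|exact: tO].
  apply: le_trans (nneseries_lim_ge n _) => //.
  rewrite -sumEFin [leRHS]big_mkcond [leRHS]big_mkord/=. apply: lee_sum => i _.
  rewrite ifT ?inE//.
  rewrite (proj2 (xy i)) lebesgue_measure_itv/=.
  rewrite lte_fin; case: ltP => [_|yx].
    by rewrite -EFinB lee_fin clamp_lip// (proj1 (xy i)).
  by rewrite lee_fin subr_le0 clamp_homo.
Qed.

End lebesgue_stieltjes.

(** * Absolutely continuous functions as integrals of their derivatives *)

Section representation.
Context {R : realType}.
Set Implicit Arguments.
Unset Strict Implicit.
Implicit Types (a b : R) (f g : R -> R).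
Notation leb := (@lebesgue_measure R).

(** Integrability is over the whole line, which is the form that the appeal to [FTC1] in
    [primitive_derive] uses. *)
Definition primitive_on a b f g :=
  leb.-integrable setT (EFin \o g) /\
  forall x, a <= x -> x <= b -> f x - f a = \int[leb]_(t in `]a, x]) g t.

(** The density is the Radon-Nikodym derivative of the Stieltjes measure of [f \o clamp a b]. *)
Lemma nondecreasing_primitive a b f : a <= b ->
  {in `[a, b] &, {homo f : x y / x <= y}} -> abs_cont_on a b f ->
  exists g, primitive_on a b f g.
Proof.
move=> ab ndf acf.
have ndF : nondecreasing (f \o clamp a b).
  move=> x y xy /=; apply: ndf; rewrite ?in_itv/= ?clamp_ge ?clamp_le//.
  exact: clamp_homo.
have rcF := right_continuousW (clamp_continuous ab acf).
pose F0 := isCumulative.Build R _ R (f \o clamp a b) ndF rcF.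
pose F : cumulative R R := HB.pack (f \o clamp a b) F0.
pose ab_ : set (measurableTypeR R) := `]a, b]%classic.
have mab : measurable ab_ by exact: measurable_itv.
have fin : (lebesgue_stieltjes_measure F ab_ < +oo)%E.
  by rewrite lebesgue_stieltjes_measure_itvoc// ltry.
(* Restricting to []a, b]] yields a finite measure, hence a charge, which can have a Radon-Nikodym
   density. *)
pose nu : {finite_measure set (measurableTypeR R) -> \bar R} := mfrestr mab fin.
have dom : nu `<< leb.
  have /null_content_dominatesP H :=
    @lebesgue_stieltjes_dominates R a b f F ab ndf acf (fun=> erefl).
  apply/null_content_dominatesP => A mA A0.
  rewrite /nu /= /mfrestr /mrestr.
  apply/eqP; rewrite -measure_le0 -(H A mA A0); apply: le_measure; rewrite ?inE//.
  exact: measurableI.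
pose ch : {charge set (measurableTypeR R) -> \bar R} := charge_of_finite_measure nu.
have intg := @Radon_Nikodym_integrable _ _ _ ch leb dom.
have RNE := @Radon_Nikodym_integral _ _ _ ch leb _ dom.
pose h := Radon_Nikodym ch leb; pose g := fine \o h.
have gE : EFin \o g = h.
  by apply/funext => x; rewrite /g/= fineK// Radon_Nikodym_fin_num.
exists g; split=> [|x ax xb]; first by rewrite gE.
rewrite /Rintegral (_ : (fun t => (g t)%:E) = h)//.
rewrite -RNE; last exact: measurable_itv.
rewrite /ch /charge_of_finite_measure/= /nu/= /mfrestr /mrestr setIidl; last first.
  by apply: subset_itvl; rewrite bnd_simp.
by rewrite lebesgue_stieltjes_measure_itvoc//= !clamp_id.
Qed.

(** Write [f = V - (V - f)] with [V] the variation function; both terms are nondecreasing because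
    increments of [V] dominate those of [f]. *)
Lemma abs_cont_on_primitive a b f : a <= b -> abs_cont_on a b f ->
  exists g, primitive_on a b f g.
Proof.
move=> ab acf.
pose V x := fine (total_variation a x f).
have acV : abs_cont_on a b V by exact: abs_cont_on_total_variation.
have tvB x y : a <= x -> x <= y -> y <= b -> `|f y - f x| <= V y - V x.
  by move=> ax xy yb; exact: (fine_total_variation_ge acf).
have [|g1 [ig1 Vg1]] := nondecreasing_primitive ab _ acV.
  move=> x y; rewrite !in_itv/= => /andP[ax _] /andP[_ yb] xy.
  by rewrite -subr_ge0 (le_trans _ (tvB _ _ ax xy yb)).
have [|g2 [ig2 Vg2]] := nondecreasing_primitive ab _ (abs_cont_onB acV acf).
  move=> x y; rewrite !in_itv/= => /andP[ax _] /andP[_ yb] xy.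
  by have := le_trans (ler_norm _) (tvB _ _ ax xy yb); lra.
exists (fun x => g1 x - g2 x); split.
  by have := integrableB measurableT ig1 ig2.
move=> x ax xb; have mI : measurable (`]a, x]%classic : set R) by exact: measurable_itv.
rewrite RintegralB//; [|exact: integrableS ig1|exact: integrableS ig2].
by rewrite -Vg1// -Vg2//; ring.
Qed.

Lemma derivable_near_shift (c x : R) F f :
  {near x, (fun y => c + F y) =1 f} -> derivable F x 1 ->
  derivable f x 1 /\ derive1 f x = derive1 F x.
Proof.
move=> nf dF.
have dcF := @derivableD _ _ _ (cst c) F x 1 (derivable_cst _ _ _) dF.
split; first exact: near_eq_derivable dcF.
rewrite !derive1E -(near_eq_derive _ nf).
transitivity ('D_1 (cst c + F) x); first by [].
by rewrite (deriveD (derivable_cst _ _ _) dF) derive_cst add0r.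
Qed.

(** [FTC1] differentiates the integral of [g] at almost every point; at an interior point of
    [[a, b]] the representation of [f] holds on a neighbourhood. *)
Lemma primitive_derive a b f g : primitive_on a b f g ->
  {ae leb, forall x, a < x -> x < b -> derivable f x 1 /\ derive1 f x = g x}.
Proof.
move=> [ig fg].
have /(@FTC1 R g (BRight a)) : forall y : R,
    leb.-integrable [set` Interval (BRight a) (BRight y)] (EFin \o g).
  by move=> y; apply: integrableS ig => //; exact: measurable_itv.
move=> /(_ (open_integrable_locally openT ig)).
apply: filterS; first exact: (ae_filter_ringOfSetsType leb).
move=> x /= H ax xb; have [|dF F'] := H; first by rewrite lte_fin.
pose F y := \int[leb]_(t in `]a, y]) g t.
have nf : {near x, (fun y => f a + F y) =1 f}.
  near=> y; rewrite /F -fg ?subrKC//; apply/ltW.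
    by near: y; exact: lt_nbhsr.
  by near: y; exact: lt_nbhsl.
have [df ->] := derivable_near_shift nf dF; split => //; exact: F'.
Unshelve. all: by end_near. Qed.

Lemma abs_cont_on_ae_derivable a b f : a <= b -> abs_cont_on a b f ->
  {ae leb, forall x, a < x -> x < b -> derivable f x 1}.
Proof.
move=> ab /(abs_cont_on_primitive ab)[g /primitive_derive].
apply: filterS; first exact: (ae_filter_ringOfSetsType leb).
by move=> x H ax xb; have [] := H ax xb.
Qed.

(** The gap between the two sides is the integral of [c - g], where [g] is almost everywhere the
    derivative. *)
Lemma abs_cont_on_ae_derive_le a b f c : a <= b -> abs_cont_on a b f ->
  {ae leb, forall x, a < x -> x < b -> derivable f x 1 -> derive1 f x <= c} ->
  f b - f a <= c * (b - a).
Proof.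
move=> ab acf f'c; have [g pg] := abs_cont_on_primitive ab acf.
have mI : measurable (`]a, b[%classic : set R) by exact: measurable_itv.
have mIc : measurable (`]a, b]%classic : set R) by exact: measurable_itv.
have ig : leb.-integrable `]a, b[ (EFin \o g) by apply: integrableS pg.1.
have ic : leb.-integrable `]a, b[ (EFin \o cst c).
  apply: (@integrableS _ _ _ leb `[a, b]).
  - exact: measurable_itv.
  - exact: measurable_itv.
  - exact: subset_itv_oo_cc.
  - apply: continuous_compact_integrable; first exact: segment_compact.
    by apply: continuous_subspaceT => x; exact: cvg_cst.
rewrite pg.2// -Rintegral_itv_bndo_bndc// -subr_ge0.
have lI : fine (leb (`]a, b[%classic : set R)) = b - a.
  rewrite lebesgue_measure_itv/= lte_fin; case: ltP => //= ba.
  by apply/esym/eqP; rewrite subr_eq0 eq_le ab ba.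
rewrite -lI -Rintegral_cst// -RintegralB//.
have mcg : measurable_fun `]a, b[ (fun x => c - g x).
  apply: measurable_realfun.measurable_funB => //.
  by apply/measurable_realfun.measurable_EFinP; exact: measurable_int ig.
rewrite /Rintegral.
(* The sign of [c - g] is known only almost everywhere; its positive part has the same integral and
   is nonnegative pointwise. *)
have -> : (\int[leb]_(x in `]a, b[) (c - g x)%:E =
           \int[leb]_(x in `]a, b[) (Num.max 0 (c - g x))%:E)%E.
  apply: ae_eq_integral => //.
  - exact/measurable_realfun.measurable_EFinP.
  - by apply/measurable_realfun.measurable_EFinP; exact: measurable_realfun.measurable_maxr.
  - have := primitive_derive pg; apply: filterS2 f'c.
      exact: (ae_filter_ringOfSetsType leb).
    move=> x f'c f'g.
    rewrite /= in_itv/= => /andP[ax xb]; have [df f'x] := f'g ax xb.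
    by rewrite max_r// subr_ge0 -f'x f'c.
by apply/fine_ge0/integral_ge0 => x _; rewrite lee_fin le_max lexx.
Qed.

End representation.

(** * Quadratic forms *)

Section quadratic_forms.
Context {R : realType}.
Set Implicit Arguments.
Unset Strict Implicit.

(** With [1%:M] this is the Euclidean inner product, so one Cauchy-Schwarz inequality serves both
    that product and the form of [J]. *)
Definition bilin n (A : 'M[R]_n) (x y : 'cV[R]_n) : R := (x^T *m A *m y) 0 0.

Lemma bilinDr n (A : 'M[R]_n) x y z : bilin A x (y + z) = bilin A x y + bilin A x z.
Proof. by rewrite /bilin mulmxDr mxE. Qed.

Lemma bilinZr n (A : 'M[R]_n) x y c : bilin A x (c *: y) = c * bilin A x y.
Proof. by rewrite /bilin -scalemxAr mxE. Qed.

Lemma bilinC n (A : 'M[R]_n) x y : A^T = A -> bilin A x y = bilin A y x.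
Proof.
move=> symA; rewrite /bilin -[in LHS](trmxK (x^T *m A *m y)) mxE.
by rewrite !trmx_mul trmxK symA mulmxA.
Qed.

Lemma bilinDl n (A : 'M[R]_n) x y z : bilin A (x + y) z = bilin A x z + bilin A y z.
Proof. by rewrite /bilin linearD/= !mulmxDl mxE. Qed.

Lemma bilinZl n (A : 'M[R]_n) x y c : bilin A (c *: x) y = c * bilin A x y.
Proof. by rewrite /bilin linearZ/= -!scalemxAl mxE. Qed.

Lemma bilin1 n (x y : 'cV[R]_n) : bilin 1%:M x y = \sum_i x i 0 * y i 0.
Proof. by rewrite /bilin mulmx1 mxE; apply: eq_bigr => i _; rewrite mxE. Qed.

Lemma bilinE n (A : 'M[R]_n) x y :
  bilin A x y = \sum_i \sum_j x i 0 * A i j * y j 0.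
Proof.
rewrite /bilin mxE exchange_big/=; apply: eq_bigr => j _.
by rewrite mxE mulr_suml; apply: eq_bigr => i _; rewrite mxE.
Qed.

Lemma posdefmx_ge0 n (A : 'M[R]_n) x : posdefmx A -> 0 <= bilin A x x.
Proof.
move=> pA; have [->|x0] := eqVneq x 0; first by rewrite /bilin mulmx0 mxE.
exact/ltW/pA.
Qed.

Lemma bilin_CauchySchwarz n (A : 'M[R]_n) x y : A^T = A -> posdefmx A ->
  bilin A x y ^+ 2 <= bilin A x x * bilin A y y.
Proof.
move=> symA pA; have [->|/pA y0] := eqVneq y 0.
  by rewrite /bilin !mulmx0 mxE expr0n mulr0.
(* Expanded, this says that [bilin A y y] times the difference of the two sides is nonnegative. *)
have := posdefmx_ge0 (bilin A y y *: x + (- bilin A x y) *: y) pA.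
rewrite !bilinDl !bilinDr !bilinZl !bilinZr (bilinC y x symA).
rewrite -/(bilin A y y) in y0.
by move: y0; nra.
Qed.

Lemma posdefmx1 n : posdefmx (1%:M : 'M[R]_n).
Proof.
move=> x /cV0Pn[i xi]; rewrite -/(bilin _ _ _) bilin1 (bigD1 i)//=.
rewrite ltr_pwDl// -?expr2 ?exprn_even_gt0//.
by apply: sumr_ge0 => j _; rewrite -expr2 sqr_ge0.
Qed.

Lemma posdefmx_unit n (A : 'M[R]_n) : posdefmx A -> A \in unitmx.
Proof.
move=> pA; rewrite unitmxE unitfE; apply/det0P => -[v v0 vA].
have /pA : v^T != 0.
  by apply: contra v0 => /eqP/(congr1 trmx); rewrite trmxK trmx0 => ->.
by rewrite trmxK vA mul0mx mxE ltxx.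
Qed.

(* [x_i = <A^-1 e_i, x>_A], so Cauchy-Schwarz for [A] bounds each coordinate. *)
Lemma posdefmx_coercive n (A : 'M[R]_n) : A^T = A -> posdefmx A ->
  exists2 K : R, 0 < K & forall x : 'cV[R]_n, \sum_i x i 0 ^+ 2 <= K * bilin A x x.
Proof.
move=> symA pA; have uA := posdefmx_unit pA.
pose y i : 'cV[R]_n := invmx A *m delta_mx i 0.
(* The leading [1] keeps the constant positive even for [n = 0]. *)
exists (1 + \sum_i bilin A (y i) (y i)).
  by rewrite ltr_pwDl// sumr_ge0// => i _; exact: posdefmx_ge0.
move=> x; rewrite mulrDl mul1r mulr_suml.
rewrite -[leLHS]add0r lerD ?posdefmx_ge0//; apply: ler_sum => i _.
suff <- : bilin A (y i) x = x i 0 by exact: bilin_CauchySchwarz.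
rewrite /bilin /y trmx_mul trmx_inv symA mulmxKV//.
by rewrite trmx_delta -rowE mxE.
Qed.

End quadratic_forms.

(** * Products, powers, and derivatives of quadratic forms along a curve *)

Section calculus.
Context {R : realType}.
Set Implicit Arguments.
Unset Strict Implicit.
Implicit Types (a b : R) (f g : R -> R).

Lemma abs_cont_on_bounded a b f : abs_cont_on a b f ->
  exists M, forall x, a <= x -> x <= b -> `|f x| <= M.
Proof.
move=> acf; exists (`|f a| + fine (total_variation a b f)) => x ax xb.
have := fine_total_variation_ge acf (lexx a) ax xb.
have := fine_total_variation_ge acf ax xb (lexx b).
rewrite total_variationxx/= subr0 => H1 H2.
rewrite -[f x](subrK (f a)) addrC (le_trans (ler_normD _ _))// lerD2l.
by rewrite (le_trans H2)// -subr_ge0 (le_trans _ H1).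
Qed.

Lemma abs_cont_onM a b f g :
  abs_cont_on a b f -> abs_cont_on a b g -> abs_cont_on a b (fun x => f x * g x).
Proof.
move=> acf acg; have [M fM] := abs_cont_on_bounded acf.
have [N gN] := abs_cont_on_bounded acg.
apply: (@abs_cont_on_dom _ _ _ N M f g) => // x y ax xy yb.
have -> : f y * g y - f x * g x = g y * (f y - f x) + f x * (g y - g x) by ring.
rewrite (le_trans (ler_normD _ _))// !normrM lerD// ler_wpM2r//.
  by rewrite gN// (le_trans ax).
by rewrite fM// (le_trans xy).
Qed.

Lemma abs_cont_on_bilin a b n (A : 'M[R]_n) (w : R -> 'cV[R]_n) :
  (forall i, abs_cont_on a b (fun t => w t i 0)) ->
  abs_cont_on a b (fun t => bilin A (w t) (w t)).
Proof.
move=> acw; under eq_fun do rewrite bilinE.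
apply: (@abs_cont_on_sum _ _ _ _ (fun i t => \sum_j w t i 0 * A i j * w t j 0)) => i.
apply: (@abs_cont_on_sum _ _ _ _ (fun j t => w t i 0 * A i j * w t j 0)) => j.
by apply: abs_cont_onM => //; apply: abs_cont_onM => //; exact: abs_cont_on_cst.
Qed.

(** Mean value theorem: as [p <= 1], the derivative of the power does not increase, so it is largest
    at [m]. *)
Lemma powR_lipschitz (p m x y : R) : 0 < p -> p <= 1 -> 0 < m -> m <= x -> x <= y ->
  `|y `^ p - x `^ p| <= p * m `^ (p - 1) * (y - x).
Proof.
move=> p0 p1 m0 mx; rewrite le_eqVlt => /predU1P[->|xy].
  by rewrite !subrr normr0 mulr0.
have x0 : 0 < x by exact: lt_le_trans mx.
have [||c cxy ->] := @MVT R (fun u => u `^ p) (fun u => p * u `^ (p - 1)) x y xy.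
- move=> u; rewrite in_itv/= => /andP[xu _].
  by apply: is_derive1_powR; exact: lt_trans xu.
- apply: derivable_within_continuous => u; rewrite in_itv/= => /andP[xu _].
  by apply: derivable_powR; rewrite in_itv/= (lt_le_trans x0 xu).
move: cxy; rewrite in_itv/= => /andP[xc _].
rewrite normrM (ger0_norm (_ : 0 <= y - x)) ?subr_ge0 ?(ltW xy)//.
rewrite ler_wpM2r ?subr_ge0 ?(ltW xy)// ger0_norm ?mulr_ge0 ?powR_ge0 ?(ltW p0)//.
rewrite ler_wpM2l ?(ltW p0)// -(opprK (p - 1)) opprB !powRN.
have c0 : 0 < c by exact: lt_trans xc.
rewrite lef_pV2 ?posrE ?powR_gt0// ge0_ler_powR ?nnegrE ?subr_ge0 ?(ltW m0) ?(ltW c0)//.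
by rewrite (le_trans mx)// ltW.
Qed.

(** By compactness [f] has a positive minimum, which keeps its values away from [0], where the power
    fails to be Lipschitz if [p < 1]. *)
Lemma abs_cont_on_powR a b (p : R) f : a <= b -> 0 < p -> p <= 1 ->
  (forall x, a <= x -> x <= b -> 0 < f x) ->
  abs_cont_on a b f -> abs_cont_on a b (fun x => f x `^ p).
Proof.
move=> ab p0 p1 f0 acf.
have [c] := EVT_min ab (abs_cont_on_within_continuous ab acf).
rewrite in_itv/= => /andP[ac cb] minf.
apply: (@abs_cont_on_dom _ _ _ (p * f c `^ (p - 1)) 0 f f) => // x y ax xy yb.
have fx : f c <= f x by apply: minf; rewrite in_itv/= ax (le_trans xy).
have fy : f c <= f y by apply: minf; rewrite in_itv/= yb (le_trans ax).
rewrite mul0r addr0; have [fxy|/ltW fyx] := leP (f x) (f y).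
  by rewrite (ger0_norm (_ : 0 <= f y - f x)) ?subr_ge0// powR_lipschitz// f0.
rewrite distrC [in leRHS]distrC (ger0_norm (_ : 0 <= f x - f y)) ?subr_ge0//.
by rewrite powR_lipschitz// f0.
Qed.

(** Product rule on each monomial; symmetry of [A] merges the two resulting sums. *)
Lemma is_derive_bilin n (A : 'M[R]_n) (w : R -> 'cV[R]_n) (v : 'cV[R]_n) (t : R) :
  A^T = A -> (forall i, is_derive t 1 (fun x => w x i 0) (v i 0)) ->
  is_derive t 1 (fun x => bilin A (w x) (w x)) (2 * bilin A (w t) v).
Proof.
move=> symA dw.
have -> : (fun x => bilin A (w x) (w x)) =
    \sum_(i < n) \sum_(j < n) (fun x => w x i 0 * A i j * w x j 0).
  apply/funext => x; rewrite bilinE fct_sumE; apply: eq_bigr => i _.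
  by rewrite fct_sumE.
have -> : 2 * bilin A (w t) v =
    \sum_(i < n) \sum_(j < n) (w t i 0 * A i j * v j 0 + v i 0 * A i j * w t j 0).
  rewrite mulr2n mulrDl !mul1r [in X in _ + X]bilinC// !bilinE -big_split/=.
  by apply: eq_bigr => i _; rewrite -big_split.
apply: is_derive_sum => i; apply: is_derive_sum => j.
have cw := is_deriveM (dw i) (is_derive_cst (A i j) t 1).
apply: (is_derive_eq (is_deriveM cw (dw j))).
rewrite scaler0 add0r.
rewrite [LHS](_ : _ = w t i 0 * A i j * v j 0 + w t j 0 * (A i j * v i 0))//.
by ring.
Qed.

End calculus.

(** * Reaching the sliding manifold *)

Section tracking.
Context {R : realType}.
Set Implicit Arguments.
Unset Strict Implicit.
Notation leb := (@lebesgue_measure R).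

Lemma sqr_enorm_bilin (v : 'cV[R]_3) : enorm v ^+ 2 = bilin 1%:M v v.
Proof. by rewrite sqr_enorm bilin1; apply: eq_bigr => i _; rewrite expr2. Qed.

Lemma enorm_gt0 (v : 'cV[R]_3) : v != 0 -> 0 < enorm v.
Proof.
move=> v0; rewrite sqrtr_gt0 -sqr_enorm sqr_enorm_bilin.
exact: posdefmx1.
Qed.

Lemma ler_enorm_bilin (u v : 'cV[R]_3) : `|bilin 1%:M u v| <= enorm u * enorm v.
Proof.
rewrite -(@ler_pXn2r _ 2) ?nnegrE ?mulr_ge0 ?enorm_ge0//.
rewrite real_normK ?num_real// exprMn !sqr_enorm_bilin.
by apply: bilin_CauchySchwarz; [exact: trmx1|exact: posdefmx1].
Qed.

(* [p * V^(p - 1) * V'] is the derivative of [V^p] for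
   [V = s^T J s], and [K * V] dominates [|s|^2]. *)
Lemma reaching_law (J : 'M[R]_3) (dmax beta1 beta2 K : R) (d s ds : 'cV[R]_3) :
  let p := (1 - beta2) / 2 in
  J^T = J -> posdefmx J -> 0 <= dmax -> 0 < beta1 -> beta2 < 1 -> 0 < K ->
  enorm s ^+ 2 <= K * bilin J s s -> enorm d <= dmax -> s != 0 ->
  J *m ds = - (J *m ((beta1 * enorm s `^ beta2) *: direction s)
               + dmax *: direction s + d) ->
  p * bilin J s s `^ (p - 1) * (2 * bilin J s ds) <= - (2 * p * beta1 * K `^ (- p)).
Proof.
move=> p Jsym Jpos dmax0 b10 b21 K0 sK dd s0 Jds.
have p0 : 0 < p by rewrite divr_gt0// subr_gt0.
have e0 : 0 < enorm s by exact: enorm_gt0.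
set e := enorm s in sK Jds e0 *; set V := bilin J s s in sK *.
have V0 : 0 < V by exact: Jpos.
have dirE : direction s = e^-1 *: s by rewrite /direction -/e e0.
(* As [direction s] is [s] divided by [e], the [dmax] term contributes [dmax * e]. *)
have sdsE : bilin J s ds = - (beta1 * e `^ (beta2 - 1) * V + dmax * e + bilin 1%:M s d).
  rewrite (_ : bilin J s ds = bilin 1%:M s (J *m ds)); last first.
    by rewrite /bilin mulmx1 mulmxA.
  rewrite Jds dirE -scaleN1r bilinZr mulN1r !bilinDr scalerA -scalemxAr.
  rewrite !bilinZr -sqr_enorm_bilin -/e.
  rewrite (_ : bilin 1%:M s (J *m s) = V); last by rewrite /bilin mulmx1 mulmxA.
  have -> : e `^ (beta2 - 1) = e `^ beta2 / e.
    by rewrite powRB ?(gt_eqF e0) ?implybT// powRr1 ?(ltW e0).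
  by field; rewrite gt_eqF.
(* By Cauchy-Schwarz the [dmax] term outweighs the worst disturbance. *)
have sd : - bilin 1%:M s d <= dmax * e.
  rewrite (le_trans (ler_norm _))// normrN (le_trans (ler_enorm_bilin _ _))//.
  by rewrite mulrC ler_wpM2r// ltW.
have sds : bilin J s ds <= - (beta1 * e `^ (beta2 - 1) * V).
  by rewrite sdsE; lra.
have KV0 : 0 < K * V by rewrite mulr_gt0.
(* Since [beta2 - 1 = 2 * - p], this is [e ^+ 2 <= K * V] raised to the power [- p], which reverses
   it. *)
have eV : K `^ (- p) * V `^ (- p) <= e `^ (beta2 - 1).
  rewrite -powRM ?(ltW K0) ?(ltW V0)// (_ : beta2 - 1 = 2 * - p); last first.
    by rewrite /p; field.
  rewrite powRrM powR_mulrn ?(ltW e0)// !powRN.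
  rewrite lef_pV2 ?posrE ?powR_gt0 ?mulr_gt0 ?exprn_gt0//.
  by rewrite ge0_ler_powR ?nnegrE ?sqr_ge0 ?(ltW KV0) ?(ltW p0).
(* The exponents [p - 1], [1] and [- p] add up to zero, so [V] drops out and the decay rate is
   constant. *)
have VV : V `^ (p - 1) * V * V `^ (- p) = 1.
  rewrite mulrAC -powRD; last by rewrite (gt_eqF V0) implybT.
  rewrite (_ : p - 1 + - p = -1); last by ring.
  by rewrite powR_inv1 ?(ltW V0)// mulVf// gt_eqF.
have pV : 0 <= p * V `^ (p - 1) by rewrite mulr_ge0 ?powR_ge0// ltW.
have sdsK : bilin J s ds <= - (beta1 * (K `^ (- p) * V `^ (- p)) * V).
  rewrite (le_trans sds)// lerN2; apply: ler_wpM2r; first exact: ltW.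
  by apply: ler_wpM2l => //; exact: ltW.
have -> : - (2 * p * beta1 * K `^ (- p)) =
    p * V `^ (p - 1) * (2 * - (beta1 * (K `^ (- p) * V `^ (- p)) * V)).
  transitivity (- (2 * p * beta1 * K `^ (- p)) * (V `^ (p - 1) * V * V `^ (- p))).
    by rewrite VV mulr1.
  by ring.
by apply: ler_wpM2l => //; exact: ler_wpM2l.
Qed.

Lemma is_derive_dot (w : R -> 'cV[R]_3) t i : derivable (fun x => w x i 0) t 1 ->
  is_derive t 1 (fun x => w x i 0) (dot w t i 0).
Proof. by move=> dw; rewrite mxE derive1E; exact/derivableP. Qed.

(** Each coordinate has its own exceptional null set; the union of the three is still null. *)
Lemma abs_cont_ae_derivable (T : R) (w : R -> 'cV[R]_3) : 0 <= T -> loc_abs_cont w ->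
  {ae leb, forall t, 0 < t -> t < T -> forall i, derivable (fun x => w x i 0) t 1}.
Proof.
move=> T0 acw.
apply: (filterS _ (_ : {ae leb, forall t, forall i, 0 < t -> t < T ->
    derivable (fun x => w x i 0) t 1})).
- exact: (ae_filter_ringOfSetsType leb).
- by move=> t H t0 tT i; exact: H.
- apply: filter_forall => i.
  by apply: abs_cont_on_ae_derivable => //; exact/abs_cont_coord/acw.
Qed.

End tracking.

Theorem proposition1 (R : realType) (J : 'M[R]_3) (dmax beta1 beta2 : R)
    (u d omegaB omegaD omegaR : R -> 'cV[R]_3)
    (J_sym : J^T = J) (J_pos : posdefmx J)
    (dmax_ge0 : 0 <= dmax) (beta1_gt0 : 0 < beta1)
    (beta2_gt0 : 0 < beta2) (beta2_lt1 : beta2 < 1)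
    (d_le : forall t : R, 0 <= t -> enorm (d t) <= dmax)
    (acB : loc_abs_cont omegaB) (acD : loc_abs_cont omegaD)
    (acR : loc_abs_cont omegaR) :
  let s := fun t : R => omegaD t + omegaR t - omegaB t in
  {ae lebesgue_measure, forall t : R, 0 <= t -> s t != 0 ->
    J *m dot omegaB t = u t + d t - cross (omegaB t) (J *m omegaB t) /\
    u t = J *m (dot omegaD t + dot omegaR t
                + (beta1 * enorm (s t) `^ beta2) *: direction (s t))
          + dmax *: direction (s t) + cross (omegaB t) (J *m omegaB t)} ->
  exists T : R, 0 <= T /\ s T = 0.
Proof.
(* If [s] never vanishes, the closed loop holds at almost every time and the quadratic form stays
   positive. *)
move=> s dyn; apply: contrapT => nexT.
have s0 t : 0 <= t -> s t != 0.
  by move=> t0; apply/eqP => st0; apply: nexT; exists t.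
have [K K0 JK] := posdefmx_coercive J_sym J_pos.
pose p : R := (1 - beta2) / 2.
have p0 : 0 < p by rewrite divr_gt0// subr_gt0.
have p1 : p <= 1 by rewrite /p; lra.
pose W t := bilin J (s t) (s t) `^ p.
pose c := 2 * p * beta1 * K `^ (- p).
have c0 : 0 < c by rewrite mulr_gt0 ?powR_gt0// mulr_gt0// mulr_gt0.
have V0 t : 0 <= t -> 0 < bilin J (s t) (s t) by move=> t0; exact/J_pos/s0.
have W0 t : 0 <= t -> 0 < W t by move=> t0; rewrite /W powR_gt0// V0.
(* Decay at rate [c] would give [W T <= W 0 - c * T = - c], against the positivity of [W]. *)
pose T := W 0 / c + 1.
have T0 : 0 < T by rewrite ltr_wpDl// divr_ge0 ?ltW// W0.
have acW : abs_cont_on 0 T W.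
  apply: abs_cont_on_powR => //; [exact: ltW|by move=> t t0 _; exact: V0|].
  apply: abs_cont_on_bilin => i.
  have sE : (fun t => s t i 0) = (fun t => omegaD t i 0 + omegaR t i 0 - omegaB t i 0).
    by apply/funext => t; rewrite !mxE.
  rewrite sE; apply: abs_cont_onB; first apply: abs_cont_onD.
  - by apply: abs_cont_coord; apply: acD => //; exact: ltW.
  - by apply: abs_cont_coord; apply: acR => //; exact: ltW.
  - by apply: abs_cont_coord; apply: acB => //; exact: ltW.
suff : W T - W 0 <= - c * (T - 0).
  rewrite subr0 mulrDr mulr1 mulNr mulrC divfK ?gt_eqF//.
  by rewrite [leLHS]addrC lerD2l leNgt (lt_trans _ (W0 _ (ltW T0))) ?oppr_lt0.
apply: abs_cont_on_ae_derive_le (ltW T0) acW _.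
have := abs_cont_ae_derivable (ltW T0) acB.
have := abs_cont_ae_derivable (ltW T0) acR.
have := abs_cont_ae_derivable (ltW T0) acD.
move=> dD dR dB.
have Flt := ae_filter_ringOfSetsType (@lebesgue_measure R).
(* Off one null set the three signals are differentiable at [t] and the closed loop holds there. *)
apply: filterS (filterI (filterI dD dR) (filterI dB dyn)) => t.
move=> [[dDt dRt] [dBt dynt]] t0 tT _.
have [dynB uE] := dynt (ltW t0) (s0 t (ltW t0)).
pose ds := dot omegaD t + dot omegaR t - dot omegaB t.
have dsE i : is_derive t 1 (fun x => s x i 0) (ds i 0).
  have dD' := is_derive_dot (dDt t0 tT i); have dR' := is_derive_dot (dRt t0 tT i).
  have dB' := is_derive_dot (dBt t0 tT i).
  have -> : (fun x => s x i 0) = (fun x => omegaD x i 0) + (fun x => omegaR x i 0)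
      - (fun x => omegaB x i 0) by apply/funext => x; rewrite !mxE.
  apply: (is_derive_eq (is_deriveB (is_deriveD dD' dR') dB')).
  by rewrite [in RHS]mxE [in RHS]mxE [X in _ = _ + X]mxE.
have dV := is_derive_bilin J_sym dsE.
have dW := is_derive1_comp (is_derive1_powR p (V0 t (ltW t0))) dV.
rewrite derive1E (_ : 'D_1 W t = p * bilin J (s t) (s t) `^ (p - 1) *
    (2 * bilin J (s t) ds)); last exact: (@derive_val _ _ _ _ _ _ _ dW).
apply: (@reaching_law _ _ dmax beta1 beta2 K (d t)) => //.
- by rewrite sqr_enorm.
- exact/d_le/ltW.
- exact/s0/ltW.
(* Substituting the control law cancels the gyroscopic term and the accelerations of the reference,
   leaving feedback, [dmax] term and disturbance. *)
- rewrite /ds mulmxBr dynB uE [J *m (_ + _ + _)]mulmxDr.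
  set X := J *m (_ + _); set Y := J *m _; set Z := dmax *: _; set C := cross _ _.
  rewrite (_ : X + Y + Z + C + d t - C = X + (Y + Z + d t)).
    by rewrite opprD addrA subrr sub0r.
  by rewrite [X + Y + Z + C + _]addrAC addrK -!addrA.
Qed.
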